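(* Let $H$ be a complex Hilbert space and let $Q \in \mathcal{L}(H)$ be an orthogonal projection. Then $Q$ satisfies property $\mathcal{AN}$ if and only if the null space of $Q$ has finite dimension or the range of $Q$ has finite dimension.
   Context: $\mathcal{L}(H)$ denotes the bounded linear operators on $H$. ''Subspace'' always means closed subspace. An operator $T\in\mathcal{L}(H,J)$ between complex Hilbert spaces satisfies property $\mathcal{N}$ if there is $x\in H$ with $\|x\|=1$ and $\|Tx\|=\|T\|$. $T$ satisfies property $\mathcal{AN}$ (is an $\mathcal{AN}$ operator) if for every closed subspace $M\subset H$, $M\ne\{0\}$, the restriction $T|_M\in\mathcal{L}(M,J)$ satisfies property $\mathcal{N}$, i.e. there is $x\in M$ with $\|x\|=1$ and $\|Tx\|=\|T|_M\|$. *)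

(* Defs.v *)
From HB Require Import structures.
From mathcomp Require Import all_boot all_order all_algebra.
From mathcomp Require Import all_classical all_reals topology normedtype.
From mathcomp Require Export complex.

Set Implicit Arguments.
Unset Strict Implicit.
Unset Printing Implicit Defensive.

Import Order.TTheory GRing.Theory Num.Theory.
Import numFieldNormedType.Exports.

Local Open Scope classical_set_scope.
Local Open Scope complex_scope.
Local Open Scope ring_scope.

(* Complex Hilbert spaces: [hdot] is linear in its first argument and
   conjugate-linear in its second one. *)
HB.mixin Record CompleteNormedModule_isHilbert (R : realType) H
    of CompleteNormedModule R[i] H := {
  hdot : {dot H for (@Num.conj R[i])} ;
  hdot_sqr_norm : forall x : H, hdot x x = `|x| ^+ 2
}.

#[short(type="hilbertType")]
HB.structure Definition Hilbert (R : realType) :=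
  {H of CompleteNormedModule R[i] H & CompleteNormedModule_isHilbert R H}.

Section Operators.
Context {R : realType} {H J : hilbertType R}.

Definition bounded_operator (T : {linear H -> J}) : Prop :=
  exists k : R, forall x : H, `|T x| <= k%:C * `|x|.

Definition closed_subspace (M : set H) : Prop :=
  submod_closed (fun x : H => x \in M) /\ closed M.

(* The operator norm of the restriction of [T] to [M].  Norms take their values
   in [R[i]] (on the real axis); the supremum is computed in [R]. *)
Definition restr_norm (T : {linear H -> J}) (M : set H) : R :=
  sup [set complex.Re `|T x| | x in [set x : H | M x /\ `|x| <= 1]].

(* [T] restricted to [M] satisfies property N *)
Definition restr_propN (T : {linear H -> J}) (M : set H) : Prop :=
  exists x : H, [/\ M x, `|x| = 1 & `|T x| = (restr_norm T M)%:C].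

Definition propAN (T : {linear H -> J}) : Prop :=
  forall M : set H, closed_subspace M -> M != [set 0] -> restr_propN T M.

(* [M] is a linear subspace with a finite basis *)
Definition finite_dim (M : set H) : Prop :=
  exists (n : nat) (e : 'I_n -> H),
    (forall c : 'I_n -> R[i], \sum_(i < n) c i *: e i = 0 -> forall i, c i = 0) /\
    M = [set x | exists c : 'I_n -> R[i], x = \sum_(i < n) c i *: e i].

End Operators.

Definition self_adjoint {R : realType} {H : hilbertType R}
    (T : {linear H -> H}) : Prop :=
  forall x y : H, hdot (T x) y = hdot x (T y).

Definition orthogonal_projection {R : realType} {H : hilbertType R}
    (Q : {linear H -> H}) : Prop :=
  (forall x : H, Q (Q x) = Q x) /\ self_adjoint Q.

(* Main.v *)
Require Import Defs.
From mathcomp Require Import all_boot all_order all_algebra.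
From mathcomp Require Import all_classical all_reals topology normedtype.
From mathcomp Require Import ring lra.
Import Order.TTheory GRing.Theory Num.Theory numFieldNormedType.Exports.
Local Open Scope classical_set_scope.
Local Open Scope complex_scope.
Local Open Scope ring_scope.

Set Implicit Arguments.
Unset Strict Implicit.
Unset Printing Implicit Defensive.

(* If the kernel and the range of [Q] are both infinite-dimensional, they
   contain orthonormal sequences [e n] and [f n]. Put [g n = e n + (n + 1) f
   n] and let [M] be the biorthogonal of the [g n]. The ratios [|Q (g n)| /
   |g n|] tend to [1], so that [Q] has norm [1] on [M]; a vector of [M]
   attaining it would be fixed by [Q], but the only such vector is [0].

   Conversely, let [M] be a nonzero closed subspace and let [U] be an
   ultrafilter containing the sets of almost maximal vectors of the unit
   ball of [M]. If [Q] converges along [U] then, by uniform convexity of the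
   ball, so does [U] itself, and its limit attains the norm. [Q] converges
   along [U] when its range is finite-dimensional, by compactness. When its
   kernel is finite-dimensional, either [M] contains a nonzero vector fixed
   by [Q], where the norm is attained, or [x |-> x - Q x] embeds [M] into
   the kernel, so that [M] is finite-dimensional and [U] converges. *)

(** * Real-valued norms on complex normed modules *)

Section RealNorm.
Context {R : realType}.

(* The norm of a complex normed module takes its values in [R[i]]; this is the
   same norm with values in [R]. *)
Definition rnorm {V : normedZmodType R[i]} (x : V) : R := complex.Re `|x|.

Lemma rnormE (V : normedZmodType R[i]) (x : V) : `|x| = (rnorm x)%:C.
Proof. exact/esym/RRe_real/normr_real. Qed.

Lemma rnorm_ge0 (V : normedZmodType R[i]) (x : V) : 0 <= rnorm x.
Proof. by rewrite -ler0c -rnormE. Qed.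

Lemma rnorm_eq0 (V : normedZmodType R[i]) (x : V) : (rnorm x == 0) = (x == 0).
Proof. by rewrite -[RHS]normr_eq0 rnormE -(inj_eq (@complexI R)). Qed.

Lemma ler_rnormD (V : normedZmodType R[i]) (x y : V) :
  rnorm (x + y) <= rnorm x + rnorm y.
Proof. by rewrite -lecR rmorphD /= -!rnormE ler_normD. Qed.

Lemma rnorm_distC (V : normedZmodType R[i]) (x y : V) :
  rnorm (x - y) = rnorm (y - x).
Proof. by rewrite /rnorm distrC. Qed.

Lemma rnormZ (V : normedModType R[i]) (a : R[i]) (x : V) :
  rnorm (a *: x) = rnorm a * rnorm x.
Proof. by apply: complexI; rewrite rmorphM /= -!rnormE normrZ. Qed.

Lemma rnormM (a b : R[i]) : rnorm (a * b) = rnorm a * rnorm b.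
Proof. by apply: complexI; rewrite rmorphM /= -!rnormE normrM. Qed.

Lemma rnorm_real (a : R) : rnorm a%:C = `|a|.
Proof.
by apply: complexI; rewrite -rnormE normc_def /= expr0n addr0 sqrtr_sqr.
Qed.

Lemma rnorm_le_ReIm (z : R[i]) :
  rnorm z <= `|complex.Re z| + `|complex.Im z|.
Proof.
rewrite /rnorm normc_def /= -[leRHS]ger0_norm ?addr_ge0 // -sqrtr_sqr.
rewrite ler_wsqrtr // -[X in X + _ <= _]real_normK ?num_real //.
rewrite -[X in _ + X <= _]real_normK ?num_real //.
by rewrite sqrrD lerD2r lerDl mulrn_wge0 // mulr_ge0.
Qed.

Lemma Re_le_rnorm (z : R[i]) : `|complex.Re z| <= rnorm z.
Proof.
by rewrite /rnorm normc_def /= -sqrtr_sqr ler_wsqrtr // lerDl sqr_ge0.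
Qed.

Lemma Im_le_rnorm (z : R[i]) : `|complex.Im z| <= rnorm z.
Proof.
by rewrite /rnorm normc_def /= -sqrtr_sqr ler_wsqrtr // lerDr sqr_ge0.
Qed.

Lemma cvg_rnormP (V : normedModType R[i]) (T : Type) (F : set_system T)
    (FF : Filter F) (f : T -> V) (y : V) :
  (f @ F --> y) <->
  (forall eps : R, 0 < eps -> \forall t \near F, rnorm (y - f t) < eps).
Proof.
split=> [/cvgrPdist_lt fy e e0|fy].
  have : 0 < e%:C by rewrite ltcR.
  by move/fy; apply: filterS => t; rewrite rnormE ltcR.
(* A positive element of [R[i]] has zero imaginary part, so the radius is real. *)
apply/cvgrPdist_lt => -[e e'] /=; rewrite ltcE /= => /andP[/eqP-> e0].
by apply: filterS (fy e e0) => t; rewrite rnormE ltcR.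
Qed.

End RealNorm.

(** * Inner products, the Cauchy-Schwarz inequality and linear subspaces *)

Section Hilbert.
Context {R : realType} {H : hilbertType R}.
Implicit Types (x y z : H) (M : set H).

Lemma hdotE x : hdot x x = (rnorm x ^+ 2)%:C.
Proof. by rewrite hdot_sqr_norm rnormE rmorphXn. Qed.

Lemma hdotC x y : hdot x y = Num.conj (hdot y x).
Proof. by rewrite hermC mul1r. Qed.

Lemma hdot_eq0C x y : hdot x y = 0 -> hdot y x = 0.
Proof. by rewrite hdotC => /eqP; rewrite conjC_eq0 => /eqP. Qed.

Lemma rnorm_parallelogram x y :
  rnorm (x + y) ^+ 2 + rnorm (x - y) ^+ 2 = 2 * rnorm x ^+ 2 + 2 * rnorm y ^+ 2.
Proof.
apply: complexI; rewrite !mulr_natl !rmorphD /= -!hdotE.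
by rewrite dnormD dnormB /=; ring.
Qed.

Lemma rnorm_pythagoras x y : hdot x y = 0 ->
  rnorm (x + y) ^+ 2 = rnorm x ^+ 2 + rnorm y ^+ 2.
Proof.
by move=> xy0; apply: complexI; rewrite rmorphD /= -!hdotE hnormDd.
Qed.

(** Pythagoras for [x], split into its component along [y] and the orthogonal remainder [z]. *)
Lemma rnorm_hdot_unit x y : rnorm y = 1 -> rnorm (hdot x y) <= rnorm x.
Proof.
move=> y1; have yy : hdot y y = 1 by rewrite hdotE y1 expr1n.
set z := x - hdot x y *: y.
have : hdot z (hdot x y *: y) = 0.
  by rewrite linearZr_LR /= linearBl linearZl_LR /= yy mulr1 subrr mulr0.
move/rnorm_pythagoras; rewrite subrK rnormZ y1 mulr1 => xE.
rewrite -(@ler_pXn2r _ 2) ?nnegrE ?rnorm_ge0 // xE.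
by rewrite lerDr sqr_ge0.
Qed.

Lemma normalize_unit x : x != 0 -> rnorm ((rnorm x)^-1%:C *: x) = 1.
Proof.
move=> x0; rewrite rnormZ rnorm_real ger0_norm ?invr_ge0 ?rnorm_ge0 //.
by rewrite mulVf // rnorm_eq0.
Qed.

Lemma rnorm_hdot x y : rnorm (hdot x y) <= rnorm x * rnorm y.
Proof.
have [->|y0] := eqVneq y 0.
  by rewrite linear0r /rnorm !normr0 mulr0.
have ny : 0 < rnorm y by rewrite lt_def rnorm_eq0 y0 rnorm_ge0.
rewrite -ler_pdivrMr //.
apply: le_trans (rnorm_hdot_unit x (normalize_unit y0)).
rewrite linearZr_LR /= conj_Creal; last by apply/complex_realP; eexists.
rewrite rnormM.
by rewrite rnorm_real ger0_norm ?invr_ge0 ?rnorm_ge0 // mulrC.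
Qed.

Section Submodule.
Variable M : set H.
Hypothesis Msub : submod_closed (fun x : H => x \in M).

Lemma submod_set0 : M 0.
Proof. by apply: set_mem; case: Msub. Qed.

Lemma submod_setZD a x y : M x -> M y -> M (a *: x + y).
Proof.
case: Msub => _ MZD Mx My; apply: set_mem.
by apply: (MZD a x y); exact: mem_set.
Qed.

Lemma submod_setZ a x : M x -> M (a *: x).
Proof.
by move=> Mx; rewrite -[_ *: _]addr0; apply: submod_setZD submod_set0.
Qed.

Lemma submod_setD x y : M x -> M y -> M (x + y).
Proof. by move=> Mx My; rewrite -[x]scale1r; apply: submod_setZD. Qed.

Lemma submod_setB x y : M x -> M y -> M (x - y).
Proof. by move=> Mx My; rewrite addrC -scaleN1r; apply: submod_setZD. Qed.

Lemma submod_set_sum (I : Type) (r : seq I) (c : I -> R[i]) (e : I -> H) :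
  (forall i, M (e i)) -> M (\sum_(i <- r) c i *: e i).
Proof.
move=> Me; elim/big_rec: _ => [|i x _ Mx]; first exact: submod_set0.
exact: submod_setZD.
Qed.

End Submodule.

End Hilbert.

(** * Orthonormal families, Gram-Schmidt and finite dimension *)

Section Orthonormal.
Context {R : realType} {H : hilbertType R}.
Implicit Types (x y z : H) (M : set H) (e : nat -> H).

(* Families are indexed by [nat] so that the same type serves for the finite
   orthonormal families [e 0, ..., e (n - 1)] and for the infinite ones. *)
Definition ortho_upto (n : nat) e :=
  forall i j, (i < n)%N -> (j < n)%N -> hdot (e i) (e j) = (i == j)%:R.

Definition fourier (n : nat) e x : H := \sum_(i < n) hdot x (e i) *: e i.

Lemma hdot_sum_ortho n e (c : 'I_n -> R[i]) (j : 'I_n) :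
  ortho_upto n e -> hdot (\sum_(i < n) c i *: e i) (e j) = c j.
Proof.
move=> eo; rewrite linear_sumlz (bigD1 j) //= big1 => [|i ij].
  by rewrite linearZl_LR /= eo // eqxx mulr1 addr0.
by rewrite linearZl_LR /= eo // (_ : (i == j :> nat) = false) ?mulr0 //;
   apply/negbTE.
Qed.

Lemma ortho_sum_eq0 n e (c : 'I_n -> R[i]) :
  ortho_upto n e -> \sum_(i < n) c i *: e i = 0 -> forall i, c i = 0.
Proof. by move=> eo c0 i; rewrite -(hdot_sum_ortho c i eo) c0 linear0l. Qed.

Lemma ortho_finite_dim M n e : submod_closed (fun x : H => x \in M) ->
  ortho_upto n e -> (forall i : 'I_n, M (e i)) ->
  (forall x, M x -> fourier n e x = x) -> finite_dim M.
Proof.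
move=> Msub eo Me spanM; exists n, (fun i => e i); split.
  by move=> c; exact: ortho_sum_eq0.
apply/seteqP; split=> [x /spanM xE|x [c ->]] /=.
  by exists (fun i => hdot x (e i)); rewrite -[LHS]xE.
exact: submod_set_sum.
Qed.

(** One Gram-Schmidt step: normalize the difference between [x] and its Fourier sum. *)
Lemma ortho_extend M n e x : submod_closed (fun x : H => x \in M) ->
  ortho_upto n e -> (forall i : 'I_n, M (e i)) -> M x -> fourier n e x != x ->
  exists v, [/\ M v, hdot v v = 1 & forall i : 'I_n, hdot v (e i) = 0].
Proof.
move=> Msub eo Me Mx; rewrite eq_sym -subr_eq0; set z := x - _ => z0.
have Mz : M z by apply: submod_setB => //; exact: submod_set_sum.
exists ((rnorm z)^-1%:C *: z); split.
- exact: submod_setZ.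
- by rewrite hdotE normalize_unit // expr1n.
- move=> i; rewrite linearZl_LR /= linearBl /= hdot_sum_ortho //.
  by rewrite subrr mulr0.
Qed.

(** As long as no finite orthonormal family in [M] spans it, [ortho_extend] supplies one more
    vector; iterating gives a sequence. *)
Lemma finite_span_or_ortho_seq M : submod_closed (fun x : H => x \in M) ->
  (exists n e, [/\ ortho_upto n e, forall i : 'I_n, M (e i) &
     forall x, M x -> fourier n e x = x]) \/
  (exists e, (forall n, ortho_upto n e) /\ forall i, M (e i)).
Proof.
move=> Msub; have [?|nspan] := pselect (exists n e, [/\ ortho_upto n e,
  forall i : 'I_n, M (e i) & forall x, M x -> fourier n e x = x]).
  by left.
right.
(* The assumptions on [l] sit under the existential, so that [choice] yields a function on all
   lists. *)
have ext (l : seq H) : exists v,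
    ortho_upto (size l) (nth 0 l) -> (forall i : 'I_(size l), M (nth 0 l i)) ->
    [/\ M v, hdot v v = 1 & forall i : 'I_(size l), hdot v (nth 0 l i) = 0].
  have [[lo Ml]|nl] := pselect (ortho_upto (size l) (nth 0 l) /\
      forall i : 'I_(size l), M (nth 0 l i)); last first.
    by exists 0 => lo Ml; case: nl.
  apply: contrapT => nv; apply: nspan; exists (size l), (nth 0 l).
  split=> // x Mx; apply/eqP/negPn/negP => /(ortho_extend Msub lo Ml Mx)[v vP].
  by apply: nv; exists v.
have [f fP] := choice ext.
pose l n := iter n (fun s => rcons s (f s)) [::].
pose e n := f (l n).
have lE n : l n = mkseq e n.
  by elim: n => // n IH; rewrite mkseqS -IH.
have szl n : size (l n) = n by rewrite lE size_mkseq.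
have nthl n i : (i < n)%N -> nth 0 (l n) i = e i.
  by move=> ?; rewrite lE nth_mkseq.
suff eP n : ortho_upto n e /\ (forall i, (i < n)%N -> M (e i)).
  by exists e; split=> [n|i]; [case: (eP n)|case: (eP i.+1) => _; apply].
elim: n => [|n [eo Me]]; first by split.
have := fP (l n); rewrite szl; case.
- by move=> i j ? ?; rewrite !nthl //; exact: eo.
- by move=> i; rewrite nthl //; exact: Me.
rewrite -/(e n) => Men enn eni.
have en0 i : (i < n)%N -> hdot (e n) (e i) = 0.
  by move=> i_n; have := eni (Ordinal i_n); rewrite nthl.
split=> [i j|i]; last by rewrite ltnS leq_eqVlt => /predU1P[->//|/Me].
rewrite !ltnS (leq_eqVlt i) (leq_eqVlt j) => /predU1P[->|i_n] /predU1P[->|j_n].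
- by rewrite eqxx.
- by rewrite en0 // gtn_eqF.
- by rewrite (hdot_eq0C (en0 _ i_n)) ltn_eqF.
- exact: eo.
Qed.

(** The coordinates of the first [n.+1] vectors in a basis of size [n] form a matrix with more rows
    than columns, hence with a nonzero left kernel. *)
Lemma finite_dim_dependent M (g : nat -> H) : finite_dim M ->
  (forall j, M (g j)) ->
  exists (n : nat) (c : 'I_n -> R[i]),
    (exists i, c i != 0) /\ \sum_(i < n) c i *: g i = 0.
Proof.
move=> [n [b [_ ->]]] /choice[A gE].
pose B : 'M[R[i]]_(n.+1, n) := \matrix_(j, i) A j i.
have : kermx B != 0.
  by rewrite kermx_eq0 -row_leq_rank -ltnNge ltnS rank_leq_col.
case/rowV0Pn => v /sub_kermxP vB v0.
exists n.+1, (v 0); split.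
  apply: contrapT => nv; case/eqP: v0; apply/rowP => i; rewrite mxE.
  by apply/eqP/negPn/negP => vi; apply: nv; exists i.
under eq_bigr do rewrite gE scaler_sumr.
rewrite exchange_big /= big1 // => i _.
under eq_bigr do rewrite scalerA.
rewrite -scaler_suml; have /rowP/(_ i) := vB.
by rewrite !mxE; under eq_bigr do rewrite mxE; move=> ->; rewrite scale0r.
Qed.

(** An infinite orthonormal sequence in [M] would contradict [finite_dim_dependent]. *)
Lemma finite_dim_spanned M : submod_closed (fun x : H => x \in M) ->
  finite_dim M ->
  exists n e, ortho_upto n e /\ forall x, M x -> fourier n e x = x.
Proof.
move=> Msub Mfin.
have [[n [e [? _ ?]]]|[e [eo Me]]] := finite_span_or_ortho_seq Msub.
  by exists n, e.
have [n [c [[i /eqP ci] c0]]] := finite_dim_dependent Mfin Me.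
by case: ci; exact: (ortho_sum_eq0 (eo n) c0).
Qed.

Lemma infinite_dim_ortho_seq M : submod_closed (fun x : H => x \in M) ->
  ~ finite_dim M -> exists e, (forall n, ortho_upto n e) /\ forall i, M (e i).
Proof.
move=> Msub Minf; have [[n [e [? ? ?]]]|//] := finite_span_or_ortho_seq Msub.
by case: Minf; exact: (@ortho_finite_dim _ n e).
Qed.

End Orthonormal.

(** * Convergence of bounded maps along ultrafilters *)

Section UltrafilterConvergence.
Context {R : realType}.

Lemma ultra_fmap (T X : Type) (f : T -> X) (U : set_system T) :
  UltraFilter U -> UltraFilter (f @ U).
Proof.
move=> UU; split=> [|G GF fUG]; first exact: fmap_proper_filter.
apply/seteqP; split=> // A GA.
have [//|UnA] := in_ultra_setVsetC (f @^-1` A) UU.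
have /(filterI GA) : G (~` A) by exact: fUG.
by rewrite setICr => /filter_not_empty.
Qed.

Variables (T : Type) (U : set_system T).
Hypothesis UU : UltraFilter U.

Lemma ultra_bounded_cvg (a : T -> R) (C : R) :
  (\forall t \near U, `|a t| <= C) -> exists l : R, a @ U --> l.
Proof.
move=> aC; have := @segment_compact R (- C) C; rewrite compact_ultra.
move=> /(_ _ (ultra_fmap a UU)) []; last by move=> l [_ al]; exists l.
by apply: filterS aC => t; rewrite /= in_itv /= ler_norml.
Qed.

Lemma ultra_bounded_cvgC (a : T -> R[i]^o) (C : R) :
  (\forall t \near U, rnorm (a t) <= C) -> exists l : R[i]^o, a @ U --> l.
Proof.
move=> aC.
have [u /cvgrPdist_lt au] : exists l : R, (fun t => complex.Re (a t)) @ U --> l.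
  by apply: (@ultra_bounded_cvg _ C); apply: filterS aC => t;
    apply: le_trans (Re_le_rnorm _).
have [v /cvgrPdist_lt av] : exists l : R, (fun t => complex.Im (a t)) @ U --> l.
  by apply: (@ultra_bounded_cvg _ C); apply: filterS aC => t;
    apply: le_trans (Im_le_rnorm _).
exists (u +i* v); apply/cvg_rnormP => eps e0.
have e2 : 0 < eps / 2 by rewrite divr_gt0.
apply: filterS2 (au _ e2) (av _ e2) => t ut vt.
apply: le_lt_trans (rnorm_le_ReIm _) _; case: (a t) ut vt => p q /= ut vt.
by rewrite (splitr eps) ltrD.
Qed.

(** Each of the finitely many coefficients is a bounded scalar, so it converges along [U]. This is
    how compactness in finite dimension enters. *)
Lemma ultra_fourier_cvg (H : hilbertType R) (n : nat) (e : nat -> H)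
    (g : T -> H) (C : R) : ortho_upto n e ->
  (\forall t \near U, rnorm (g t) <= C) ->
  exists y : H, (fun t => fourier n e (g t)) @ U --> y.
Proof.
move=> eo gC.
have /choice[l al] (i : 'I_n) :
    exists l : R[i]^o, (fun t => hdot (g t) (e i) : R[i]^o) @ U --> l.
  apply: (@ultra_bounded_cvgC _ C); apply: filterS gC => t; apply: le_trans.
  apply: rnorm_hdot_unit; apply/eqP; rewrite -(@eqrXn2 _ 2) ?rnorm_ge0 //.
  by rewrite -(inj_eq (@complexI R)) -hdotE eo // eqxx expr1n.
exists (\sum_(i < n) l i *: e i).
apply: cvg_big => [|i _]; first exact: add_continuous.
by apply: cvgZr_tmp; exact: al.
Qed.

End UltrafilterConvergence.

(** * Norm attainment for a bounded operator on a closed subspace *)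

Section NormAttainment.
Context {R : realType} {H J : hilbertType R}.
Implicit Types x : H.
Variables (T : {linear H -> J}) (M : set H).
Hypotheses (Tbounded : bounded_operator T) (Mclosed : closed_subspace M).

Let Msub : submod_closed (fun x : H => x \in M) := proj1 Mclosed.

Let s := restr_norm T M.

Let ballE x : (`|x| <= 1 :> R[i]) = (rnorm x <= 1).
Proof. by rewrite rnormE -[1]/(1%:C) lecR. Qed.

Lemma bounded_rnorm : exists2 k : R, 0 < k &
  forall x, rnorm (T x) <= k * rnorm x.
Proof.
(* The given [k] may be zero or negative; a positive constant can later be divided by. *)
have [k kT] := Tbounded; exists (`|k| + 1) => [|x]; first by rewrite ltr_wpDl.
rewrite (@le_trans _ _ (k * rnorm x)) ?ler_wpM2r ?rnorm_ge0 //.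
  by rewrite -lecR rmorphM /= -!rnormE.
by rewrite (le_trans (ler_norm _)) // lerDl.
Qed.

Lemma restr_norm_has_sup :
  has_sup [set complex.Re `|T x| | x in [set x : H | M x /\ `|x| <= 1]].
Proof.
split; first by exists (complex.Re `|T 0|), 0 => //; split;
  [exact: submod_set0|rewrite normr0].
have [k k0 kT] := bounded_rnorm.
exists k => _ [x [_ +] <-]; rewrite ballE => x1.
by rewrite (le_trans (kT x)) // ler_piMr // ltW.
Qed.

Lemma restr_norm_ge0 : 0 <= s.
Proof.
have ub := sup_upper_bound restr_norm_has_sup.
rewrite (@le_trans _ _ (rnorm (T 0))) ?rnorm_ge0 //; apply: ub.
by exists 0 => //; split; [exact: submod_set0|rewrite normr0].
Qed.

Lemma restr_norm_bound x : M x -> rnorm (T x) <= s * rnorm x.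
Proof.
move=> Mx; have [->|x0] := eqVneq x 0.
  by rewrite linear0 /rnorm !normr0 /= mulr0.
have nx : 0 < rnorm x by rewrite lt_def rnorm_eq0 x0 rnorm_ge0.
rewrite -ler_pdivrMr // mulrC.
rewrite -[_^-1]ger0_norm ?invr_ge0 ?rnorm_ge0 // -rnorm_real -rnormZ -linearZ.
apply: (sup_upper_bound restr_norm_has_sup); eexists; last reflexivity.
by split; [exact: submod_setZ|rewrite ballE normalize_unit].
Qed.

Lemma restr_propN_ge x : M x -> x != 0 -> s * rnorm x <= rnorm (T x) ->
  restr_propN T M.
Proof.
move=> Mx x0 sx; have nx : rnorm x != 0 by rewrite rnorm_eq0.
have sE : rnorm (T x) = s * rnorm x.
  by apply/le_anti; rewrite sx restr_norm_bound.
exists ((rnorm x)^-1%:C *: x); split; first exact: submod_setZ.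
  by rewrite rnormE normalize_unit.
rewrite rnormE linearZ rnormZ rnorm_real ger0_norm ?invr_ge0 ?rnorm_ge0 //.
by rewrite sE mulrCA mulVf // mulr1.
Qed.

Definition near_maximal : set_system H :=
  filter_from [set eps : R | 0 < eps]
    (fun eps => [set x | [/\ M x, rnorm x <= 1 & s - eps < rnorm (T x)]]).

Lemma near_maximal_proper : ProperFilter near_maximal.
Proof.
apply: filter_from_proper; first apply: filter_from_filter.
- by exists 1 => /=.
- move=> a b /= a0 b0; exists (Num.min a b); first by rewrite /= lt_min a0.
  move=> x [Mx x1 xs]; split; split=> //; apply: le_lt_trans xs.
    by rewrite lerD2l lerN2 ge_min lexx.
  by rewrite lerD2l lerN2 ge_min lexx orbT.
- move=> eps /= e0.
  have [_ [x [Mx +] <-]] := sup_adherent e0 restr_norm_has_sup.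
  by rewrite ballE => x1 ?; exists x.
Qed.

(* The unit ball is uniformly convex: if [T x] and [T x'] are close to each
   other and both almost maximal in norm, then [x + x'] has norm almost [2], so
   that [x - x'] is small by the parallelogram identity. *)
Lemma near_maximal_close x x' d : 0 < s -> M x -> M x' -> rnorm x <= 1 ->
  rnorm x' <= 1 -> s * (1 - d) <= rnorm (T x) ->
  rnorm (T x - T x') <= 2 * s * d ->
  rnorm (x - x') ^+ 2 <= 16 * d.
Proof.
move=> s0 Mx Mx' x1 x1' Tx Txx'.
have := rnorm_parallelogram x x'.
(* Writing [2 T x] as [(T x + T x') + (T x - T x')] gives [2 s (1 - d) <= s |x + x'| + 2 s d]. *)
have lower : 2 - 4 * d <= rnorm (x + x').
  have := restr_norm_bound (submod_setD Msub Mx Mx'); rewrite linearD /=.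
  have := ler_rnormD (T x + T x') (T x - T x').
  rewrite addrACA subrr addr0 -mulr2n -scaler_nat rnormZ.
  rewrite (_ : rnorm 2%:R = 2); last first.
    by rewrite (_ : 2%:R = (2%:R)%:C) ?rnorm_real ?rmorph_nat // ger0_norm.
  move=> h1 h2; rewrite -(ler_pM2l s0); lra.
(* If [d <= 1 / 2], then [lower] can be squared and [4 - (2 - 4 d)^2 <= 16 d]; otherwise the trivial
   bound [4] suffices. *)
have [d2|d2] := lerP d (1 / 2); have := rnorm_ge0 x; have := rnorm_ge0 x';
  have := rnorm_ge0 (x + x'); nra.
Qed.

Lemma ultra_maximal_cvg (U : set_system H) (y : J) : 0 < s ->
  UltraFilter U -> near_maximal `<=` U -> T @ U --> y -> exists x : H, U --> x.
Proof.
move=> s0 UU maxU /cvg_rnormP Ty.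
have FU : Filter U by exact: filter_filter.
suff : cauchy U by move/cauchy_cvgP => Uc; exists (lim U).
apply: cauchy_exP => -[e e'] /=; rewrite ltcE /= => /andP[/eqP-> e0].
(* With this choice [16 * d] is half of [e ^+ 2], which leaves a strict inequality. *)
pose d := e ^+ 2 / 32.
have d0 : 0 < d by rewrite divr_gt0 ?exprn_gt0.
have sd0 : 0 < s * d by rewrite mulr_gt0.
have Umax : U [set x | [/\ M x, rnorm x <= 1 & s - s * d < rnorm (T x)]].
  by apply: maxU; exists (s * d).
have Uy := @filterI _ U FU _ _ Umax (Ty _ sd0).
have [x [[Mx x1 sx] xy]] := filter_ex Uy.
exists x; apply: filterS Uy => x' [[Mx' x1' _] x'y].
rewrite -ball_normE /= rnormE ltcR.
have : rnorm (x - x') ^+ 2 <= 16 * d.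
  apply: near_maximal_close => //; first by rewrite mulrBr mulr1 ltW.
  have := ler_rnormD (T x - y) (y - T x').
  rewrite addrA subrK => /le_trans; apply.
  by rewrite rnorm_distC -mulrA mulr_natl mulr2n ltW // ltrD.
move=> h; rewrite -(@ltr_pXn2r _ 2) ?nnegrE ?rnorm_ge0 ?ltW //.
have := exprn_gt0 2 e0; rewrite /d in h; lra.
Qed.

Lemma ultra_maximal_lim (U : set_system H) (x : H) :
  UltraFilter U -> near_maximal `<=` U -> U --> x ->
  [/\ M x, rnorm x <= 1 & s <= rnorm (T x)].
Proof.
move=> UU maxU Ux; have /cvg_rnormP xP : id @ U --> x := Ux.
have FU : Filter U by exact: filter_filter.
have Uball : U [set x | M x /\ rnorm x <= 1].
  by apply: maxU; exists 1 => //= z [].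
have [k k0 kT] := bounded_rnorm.
split.
- apply: (closed_cvg _ (proj2 Mclosed) _ _ Ux).
  by apply: filterS Uball => z [].
- apply/ler_addgt0Pr => e e0.
  have Ux' := @filterI _ U FU _ _ Uball (xP _ e0).
  have [z [[_ z1] xz]] := filter_ex Ux'.
  have := ler_rnormD (x - z) z; rewrite subrK /= => /le_trans; apply.
  by rewrite addrC lerD // ltW.
- apply/ler_addgt0Pr => e e0.
  have e2 : 0 < e / 2 by rewrite divr_gt0.
  have ek : 0 < e / 2 / k by rewrite divr_gt0.
  have Umax : U [set x | [/\ M x, rnorm x <= 1 & s - e / 2 < rnorm (T x)]].
    by apply: maxU; exists (e / 2).
  have Ux' := @filterI _ U FU _ _ Umax (xP _ ek).
  have [z [[_ _ sz] xz]] := filter_ex Ux'.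
  have := ler_rnormD (T z - T x) (T x); rewrite subrK -linearB /=.
  have := kT (z - x); rewrite rnorm_distC.
  move: xz; rewrite /= ltr_pdivlMr // mulrC.
  by move: (k * _) => q; lra.
Qed.

Lemma restr_propN_cvg : M != [set 0] ->
  (forall U : set_system H, UltraFilter U -> near_maximal `<=` U ->
     exists y : J, T @ U --> y) ->
  restr_propN T M.
Proof.
move=> M0 Tcvg; have := restr_norm_ge0; rewrite le_eqVlt => /predU1P[s0|s0].
  (* When [s = 0] any nonzero vector of [M] will do; the convexity argument needs [0 < s]. *)
  have [x [Mx x0]] : exists x, M x /\ x != 0.
    apply: contrapT => nx; case/eqP: M0; apply/seteqP; split=> [x Mx|_ ->] /=.
      by apply/eqP/negPn/negP => x0; apply: nx; exists x.
    exact: submod_set0.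
  by apply: (restr_propN_ge Mx x0); rewrite -s0 mul0r rnorm_ge0.
have [U [UU maxU]] := ultraFilterLemma near_maximal_proper.
have [y Ty] := Tcvg U UU maxU; have [x Ux] := ultra_maximal_cvg s0 UU maxU Ty.
have [Mx x1 sx] := ultra_maximal_lim UU maxU Ux.
apply: (restr_propN_ge Mx); last by apply: le_trans sx; rewrite ler_piMr // ltW.
apply: contraTneq sx => ->; rewrite linear0 -ltNge.
by rewrite (_ : rnorm 0 = 0) //; apply/eqP; rewrite rnorm_eq0.
Qed.

End NormAttainment.

(** * Orthogonal projections and the two finite-dimensional cases *)

Section OrthogonalProjection.
Context {R : realType} {H : hilbertType R}.
Variable Q : {linear H -> H}.
Hypotheses (Qbounded : bounded_operator Q) (Qproj : orthogonal_projection Q).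
Implicit Types (x y : H) (M : set H).

(** [Q x] and [x - Q x] are orthogonal because [Q] is idempotent and self-adjoint. *)
Lemma proj_pythagoras x :
  rnorm x ^+ 2 = rnorm (Q x) ^+ 2 + rnorm (x - Q x) ^+ 2.
Proof.
have [QQ Qsa] := Qproj; rewrite -rnorm_pythagoras ?subrKC //.
by rewrite linearBr /= -{1}QQ Qsa subrr.
Qed.

Lemma proj_rnorm_le x : rnorm (Q x) <= rnorm x.
Proof.
rewrite -(@ler_pXn2r _ 2) ?nnegrE ?rnorm_ge0 // [leRHS]proj_pythagoras.
by rewrite lerDl sqr_ge0.
Qed.

Lemma proj_rnorm_eq x : rnorm x <= rnorm (Q x) -> Q x = x.
Proof.
move=> le_x_Qx; have := proj_pythagoras x.
have -> : rnorm (Q x) = rnorm x by apply/le_anti; rewrite proj_rnorm_le.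
move/eqP; rewrite eq_sym addrC -subr_eq0 addrK sqrf_eq0 rnorm_eq0 subr_eq0.
by move/eqP.
Qed.

Lemma submod_ker : submod_closed (fun x : H => x \in Q @^-1` [set 0]).
Proof.
split=> [|a x y /set_mem /= Qx /set_mem /= Qy]; apply: mem_set => /=.
  exact: linear0.
by rewrite linearP Qx Qy scaler0 addr0.
Qed.

Lemma submod_range : submod_closed (fun x : H => x \in range Q).
Proof.
split=> [|a x y]; first by apply: mem_set; exists 0; rewrite ?linear0.
move=> /set_mem[x' _ <-] /set_mem[y' _ <-]; apply: mem_set.
by exists (a *: x' + y') => //; rewrite linearP.
Qed.

Lemma finite_range_propAN : finite_dim (range Q) -> propAN Q.
Proof.
move=> Qfin M Mclosed M0; apply: restr_propN_cvg => // U UU maxU.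
have [n [e [eo eE]]] := finite_dim_spanned submod_range Qfin.
rewrite (_ : (Q : H -> H) = fun x => fourier n e (Q x)); last first.
  by apply/funext => x; rewrite eE.
apply: (@ultra_fourier_cvg _ _ _ UU _ _ _ _ 1 eo).
apply: maxU; exists 1 => //= x [_ x1 _].
exact: le_trans (proj_rnorm_le _) x1.
Qed.

Lemma finite_ker_propAN : finite_dim (Q @^-1` [set 0]) -> propAN Q.
Proof.
move=> Qfin M Mclosed M0; have Msub := proj1 Mclosed.
have [[x [Mx x0 Qx]]|Qinj] := pselect (exists x, [/\ M x, x != 0 & Q x = x]).
  apply: (restr_propN_ge Qbounded Mclosed Mx x0).
  rewrite Qx ler_piMl ?rnorm_ge0 //.
  (* A fixed vector attains the norm as soon as [restr_norm Q M <= 1], which holds since [Q] is a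
     contraction. *)
  apply: ge_sup; first by case: (restr_norm_has_sup Qbounded Mclosed).
  move=> _ [y [_ y1] <-]; apply: le_trans (proj_rnorm_le y) _.
  by rewrite -lecR -rnormE.
have [[n [e [eo _ eE]]]|[e [eo Me]]] := finite_span_or_ortho_seq Msub.
  apply: restr_propN_cvg => // U UU maxU.
  have Uball : U [set x | M x /\ rnorm x <= 1].
    by apply: maxU; exists 1 => //= x [].
  have [|y /cvg_rnormP ey] := @ultra_fourier_cvg _ _ _ UU _ n e id 1 eo.
    by apply: filterS Uball => x [].
  exists (Q y); apply/cvg_rnormP => eps e0.
  apply: filterS2 Uball (ey _ e0) => x [Mx _]; rewrite eE // -linearB.
  by apply: le_lt_trans; exact: proj_rnorm_le.
(* A linear relation between these vectors of the kernel says that the same combination of the [e j]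
   is fixed by [Q]. By [Qinj] it is zero, so orthonormality kills the coefficients. *)
have [] := @finite_dim_dependent _ _ _ (fun j => e j - Q (e j)) Qfin.
  by have [QQ _] := Qproj; move=> j; rewrite /= linearB QQ subrr.
move=> n [c [[i /eqP ci] c0]]; case: ci; apply: (ortho_sum_eq0 (eo n)).
apply/eqP/negPn/negP => s0; apply: Qinj; exists (\sum_(i < n) c i *: e i).
split=> //; first exact: submod_set_sum.
apply/eqP; rewrite eq_sym -subr_eq0 -[X in _ == X]c0 linear_sum -sumrB.
by under eq_bigr do rewrite linearZ -scalerBr.
Qed.

(** The double orthogonal complement, that is, the closed linear span of the [g n], described by
    inner products alone. *)
Definition biorthogonal (g : nat -> H) : set H :=
  [set x | forall y, (forall n, hdot y (g n) = 0) -> hdot x y = 0].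

(** Orthogonality to a given [y] passes to limits by Cauchy-Schwarz. *)
Lemma biorthogonal_closed g : closed_subspace (biorthogonal g).
Proof.
split.
  split=> [|a x y /set_mem gx /set_mem gy]; apply: mem_set => z gz.
    by rewrite linear0l.
  by rewrite linearDl linearZl_LR /= gx // gy // mulr0 addr0.
move=> x clx y gy; apply/eqP; rewrite -rnorm_eq0 eq_le rnorm_ge0 andbT.
apply/ler_addgt0Pr => eps e0; rewrite add0r.
(* The added [1] keeps the divisor positive when [y = 0]. *)
have d0 : 0 < rnorm y + 1 by rewrite ltr_wpDl ?rnorm_ge0.
have ed0 : 0 < (eps / (rnorm y + 1))%:C by rewrite ltcR divr_gt0.
have [z [gz]] := clx _ (nbhsx_ballx x _ ed0).
rewrite -ball_normE /= rnormE ltcR ltr_pdivlMr // => /ltW xz.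
rewrite -[x](subrK z) linearDl /= gz // addr0.
apply: le_trans (rnorm_hdot _ _) (le_trans _ xz).
by rewrite ler_wpM2l ?rnorm_ge0 // lerDl.
Qed.

(** * A subspace where the norm is not attained *)

Section InfiniteDimensional.
Variables e f : nat -> H.
Hypotheses (eo : forall n, ortho_upto n e) (fo : forall n, ortho_upto n f).
Hypotheses (eker : forall n, Q (e n) = 0) (fran : forall n, Q (f n) = f n).

Let g n : H := e n + n.+1%:R *: f n.

Let hdot_ee m n : hdot (e m) (e n) = (m == n)%:R.
Proof.
by apply: (@eo (maxn m n).+1); rewrite ltnS ?leq_maxl ?leq_maxr.
Qed.

Let hdot_ff m n : hdot (f m) (f n) = (m == n)%:R.
Proof.
by apply: (@fo (maxn m n).+1); rewrite ltnS ?leq_maxl ?leq_maxr.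
Qed.

Let hdot_ef m n : hdot (e m) (f n) = 0.
Proof. by have [_ Qsa] := Qproj; rewrite -fran -Qsa eker linear0l. Qed.

Let g_biorthogonal n : biorthogonal g (g n).
Proof. by move=> y /(_ n)/hdot_eq0C. Qed.

Let rnorm_f n : rnorm (f n) = 1.
Proof.
apply/eqP; rewrite -(@eqrXn2 _ 2) ?rnorm_ge0 //.
by rewrite -(inj_eq (@complexI R)) -hdotE hdot_ff eqxx expr1n.
Qed.

Let rnorm_g n : rnorm (g n) ^+ 2 = 1 + n.+1%:R ^+ 2.
Proof.
rewrite rnorm_pythagoras ?linearZr_LR /= ?hdot_ef ?mulr0 //.
rewrite rnormZ rnorm_f mulr1; congr (_ + _ ^+ 2).
  by apply: complexI; rewrite -hdotE hdot_ee eqxx.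
by rewrite -(rmorph_nat (real_complex R)) rnorm_real ger0_norm.
Qed.

Let rnorm_Qg n : rnorm (Q (g n)) = n.+1%:R.
Proof.
rewrite linearD linearZ /= eker fran add0r rnormZ rnorm_f mulr1.
by rewrite -(rmorph_nat (real_complex R)) rnorm_real ger0_norm.
Qed.

(* [(n + 1) e n - f n] is orthogonal to every [g m]; hence a vector of the
   biorthogonal of [g] that is fixed by [Q], being orthogonal to [e n], is also
   orthogonal to [f n]. *)
Let biorthogonal_fixed x : biorthogonal g x -> Q x = x -> x = 0.
Proof.
move=> gx Qx.
have xe n : hdot x (e n) = 0.
  by have [_ Qsa] := Qproj; rewrite -Qx Qsa eker linear0r.
have xf n : hdot x (f n) = 0.
  have /gx : forall m, hdot (n.+1%:R *: e n - f n) (g m) = 0.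
    move=> m; rewrite /g linearBl /= linearZl_LR /=.
    rewrite !linearDr /= !linearZr_LR /=.
    rewrite hdot_ee hdot_ef hdot_ff (hdot_eq0C (hdot_ef _ _)) rmorph_nat.
    rewrite mulr0 addr0 add0r.
    by have [->|_] := eqVneq n m; rewrite ?subrr // !mulr0 subrr.
  rewrite linearBr /= linearZr_LR /= xe mulr0 sub0r => /eqP.
  by rewrite oppr_eq0 => /eqP.
have /gx xx : forall n, hdot x (g n) = 0.
  by move=> n; rewrite linearDr /= linearZr_LR /= xe xf mulr0 addr0.
by apply/eqP; rewrite -(dnorm_eq0 hdot) xx.
Qed.

Lemma infinite_dim_not_propAN : ~ propAN Q.
Proof.
have Mclosed := biorthogonal_closed g.
move=> /(_ _ Mclosed); case=> [|x [gx]].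
  apply/eqP => M0; have := g_biorthogonal 0; rewrite M0 /= => g0.
  have := rnorm_g 0; rewrite g0 (eqP (_ : rnorm 0 == 0)) ?rnorm_eq0 //.
  by rewrite expr0n expr1n /=; lra.
set s := restr_norm _ _; rewrite !rnormE => /complexI x1 /complexI Qxs.
have s0 : 0 <= s by rewrite -Qxs rnorm_ge0.
(* Otherwise the unit vector [x] attaining the norm would be fixed by [Q], hence zero. *)
have s1 : s < 1.
  rewrite ltNge; apply/negP; rewrite -x1 -Qxs => /proj_rnorm_eq Qx.
  move: x1; rewrite (biorthogonal_fixed gx Qx).
  rewrite (eqP (_ : rnorm 0 == 0)) ?rnorm_eq0 // => /eqP.
  by rewrite eq_sym oner_eq0.
(* Squaring the bound at [g n] gives [(n + 1)^2 <= s^2 (1 + (n + 1)^2)]. *)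
have gs n : (1 - s ^+ 2) * n.+1%:R ^+ 2 <= 1.
  have := restr_norm_bound Qbounded Mclosed (g_biorthogonal n).
  rewrite -(@ler_pXn2r _ 2) ?nnegrE ?mulr_ge0 ?rnorm_ge0 //.
  rewrite exprMn rnorm_g rnorm_Qg -/s => h.
  have : s ^+ 2 <= 1 by rewrite expr_le1 // ltW.
  nra.
have t0 : 0 < 1 - s ^+ 2 by rewrite subr_gt0 expr_lt1.
(* This [n] makes [(1 - s^2) (n + 1)] exceed [1], against [gs n]. *)
have := truncnS_gt (1 - s ^+ 2)^-1; set n := Num.truncn _.
rewrite -[_^-1]mul1r ltr_pdivrMr //; apply/negP; rewrite -leNgt.
apply: le_trans (gs n); rewrite mulrC ler_pM2l // expr2 ler_peMr // ler1n //.
Qed.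

End InfiniteDimensional.

End OrthogonalProjection.

Theorem theorem3p10 (R : realType) (H : hilbertType R) (Q : {linear H -> H})
    (Qbounded : bounded_operator Q) (Qproj : orthogonal_projection Q) :
  propAN Q <-> finite_dim (Q @^-1` [set 0]) \/ finite_dim (range Q).
Proof.
split=> [QAN|[]]; [|exact: finite_ker_propAN|exact: finite_range_propAN].
apply: contrapT => /not_orP[kinf rinf].
have [e [eo eker]] := infinite_dim_ortho_seq (submod_ker Q) kinf.
have [f [fo fran]] := infinite_dim_ortho_seq (submod_range Q) rinf.
apply: (infinite_dim_not_propAN Qbounded Qproj eo fo eker) QAN.
by move=> n; have [x _ <-] := fran n; case: Qproj.
Qed.
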